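(* Let $Q=\{1,2,\dots,p\}$ and, for every $q\in Q$, let $f_q:\mathbb{R}^n\to\mathbb{R}$ be a convex function and $C_q\subset\mathbb{R}^n$ a nonempty closed convex set; set $M_q(x)=\partial f_q(x)+N_{C_q}(x)$. Suppose the set $$A:=\bigcap_{q\in Q}A_q,\qquad A_q:=\operatorname{arg\,min}_{x\in C_q} f_q(x),$$ is nonempty. Let $\sigma:[0,\infty)\to Q$ be a switching signal such that, for each $q\in Q$, $\mu(T_q(\sigma))=\infty$, where $T_q(\sigma):=\{t\in[0,\infty)\mid \sigma(t)=q\}$ and $\mu$ is Lebesgue measure. Then every complete solution $\phi$ of the switching system $\dot x\in -M_{\sigma(t)}(x)$ is such that $\lim_{t\to\infty}\phi(t)$ exists and belongs to $A$.
   Context: $\partial f_q(x)$ denotes the convex-analysis subdifferential $\{y\in\mathbb{R}^n \mid f_q(x')\ge f_q(x)+y\cdot(x'-x)\ \forall x'\in\mathbb{R}^n\}$. $N_{C}(x)$ is the normal cone $\{v\in\mathbb{R}^n\mid v\cdot(x'-x)\le 0\ \forall x'\in C\}$ if $x\in C$, and $N_C(x)=\emptyset$ if $x\notin C$. A switching signal is a function $\sigma:[0,\infty)\to Q$ for which there is a sequence $0=t_0<t_1<t_2<\dots$ (with $t_j\to\infty$) such that $\sigma$ is constant on each $[t_j,t_{j+1})$. Given $\sigma$, a solution is a locally absolutely continuous function $\phi:\operatorname{dom}\phi\to\mathbb{R}^n$, with $\operatorname{dom}\phi$ equal to $[0,T)$, $[0,T]$ or $[0,\infty)$, such that $\dot\phi(t)\in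 -M_{\sigma(t)}(\phi(t))$ for almost every $t\in\operatorname{dom}\phi$. A solution is complete if $\operatorname{dom}\phi=[0,\infty)$. *)

(* Defs.v *)
From HB Require Import structures.
From mathcomp Require Import all_boot all_order all_algebra.
From mathcomp Require Import all_classical all_reals all_analysis.
Set Implicit Arguments. Unset Strict Implicit. Unset Printing Implicit Defensive.
Import Order.TTheory GRing.Theory Num.Theory.
Import numFieldNormedType.Exports.
Local Open Scope classical_set_scope.
Local Open Scope ring_scope.

Definition dotp (R : realType) (n : nat) (x y : 'rV[R]_n) : R :=
  \sum_(i < n) x ord0 i * y ord0 i.

Definition convex_fun (R : realType) (n : nat) (f : 'rV[R]_n -> R) : Prop :=
  forall (x y : 'rV[R]_n) (l : R), 0 <= l -> l <= 1 ->
    f (l *: x + (1 - l) *: y) <= l * f x + (1 - l) * f y.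

Definition convex_set_rV (R : realType) (n : nat) (C : set 'rV[R]_n) : Prop :=
  forall (x y : 'rV[R]_n) (l : R), C x -> C y -> 0 <= l -> l <= 1 ->
    C (l *: x + (1 - l) *: y).

Definition subdiff (R : realType) (n : nat) (f : 'rV[R]_n -> R) (x : 'rV[R]_n)
  : set 'rV[R]_n :=
  [set y | forall x' : 'rV[R]_n, f x' >= f x + dotp y (x' - x)].

Definition normal_cone (R : realType) (n : nat) (C : set 'rV[R]_n) (x : 'rV[R]_n)
  : set 'rV[R]_n :=
  [set v | C x /\ forall x', C x' -> dotp v (x' - x) <= 0].

Definition Mop (R : realType) (n : nat) (f : 'rV[R]_n -> R) (C : set 'rV[R]_n)
  (x : 'rV[R]_n) : set 'rV[R]_n :=
  [set z | exists a b, [/\ subdiff f x a, normal_cone C x b & z = a + b]].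

Definition argmin_on (R : realType) (n : nat) (f : 'rV[R]_n -> R) (C : set 'rV[R]_n)
  : set 'rV[R]_n :=
  [set x | C x /\ forall y, C y -> f x <= f y].

(* switching signal sigma : [0,oo) -> Q (values at t<0 irrelevant) *)
Definition switching_signal (R : realType) (Q : Type) (sigma : R -> Q) : Prop :=
  exists tj : nat -> R,
    [/\ tj 0%N = 0,
        (forall j, tj j < tj j.+1),
        tj @ \oo --> +oo &
        (forall j s, tj j <= s -> s < tj j.+1 -> sigma s = sigma (tj j))].

(* absolute continuity on [a,b], with finite families of nonoverlapping
   subintervals listed in increasing order *)
Definition abs_cont_on (R : realType) (V : normedModType R) (f : R -> V) (a b : R)
  : Prop :=
  forall eps : R, 0 < eps -> exists2 delta : R, 0 < delta &
    forall (k : nat) (x y : nat -> R),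
      (forall i, (i < k)%N -> a <= x i /\ x i <= y i /\ y i <= b) ->
      (forall i, (i.+1 < k)%N -> y i <= x i.+1) ->
      \sum_(i < k) (y i - x i) < delta ->
      \sum_(i < k) `|f (y i) - f (x i)| < eps.

(* complete solution: defined on [0,oo) (values at t<0 irrelevant), locally
   absolutely continuous, and phi'(t) \in - M_{sigma t}(phi t) for a.e. t >= 0 *)
Definition complete_solution (R : realType) (n p : nat)
  (f : 'I_p -> 'rV[R]_n -> R) (C : 'I_p -> set 'rV[R]_n) (sigma : R -> 'I_p)
  (phi : R -> 'rV[R]_n) : Prop :=
  (forall T : R, 0 <= T -> abs_cont_on phi 0 T) /\
  {ae (@lebesgue_measure R), forall t : R, 0 <= t ->
      derivable phi t 1 /\ Mop (f (sigma t)) (C (sigma t)) (phi t) (- 'D_1 phi t)}.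

(* Main.v *)
Require Import Defs.
From HB Require Import structures.
From mathcomp Require Import all_boot all_order all_algebra.
From mathcomp Require Import all_classical all_reals all_analysis.
From mathcomp Require Import lra.
Set Implicit Arguments. Unset Strict Implicit. Unset Printing Implicit Defensive.
Import Order.TTheory GRing.Theory Num.Theory.
Import numFieldNormedType.Exports.
Local Open Scope classical_set_scope.
Local Open Scope ring_scope.

(* Write V_y t = |phi t - y|^2 (Euclidean). Along a solution in mode q,
   V_y' <= 2 (f_q y - f_q (phi t)) for every y in C_q, so V_z is nonincreasing
   for z in A and phi has a cluster point x. By lower semicontinuity of the f_q
   and closedness of the C_q, every y in C_q near x satisfies x in C_q and
   f_q x + f_q z <= 2 f_q y. Hence V_x + V_z is nonincreasing as long as phi
   stays in a small ball around x. Since V_z converges, phi cannot leave the ball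
   once it has entered deeply and late enough, so phi converges to x. If x were
   not in A_q, then f_q - min f_q would be bounded below by some d > 0 on C_q
   near x, and V_z would decrease at rate at least 2 d during the infinite total
   time spent in mode q. *)

(** * Real induction and monotonicity of absolutely continuous functions *)

(** The local hypothesis at [sup S] carries [P] from a reachable point just before [sup S] to as
    much as [d / 2] beyond it, so [sup S] must be [b] and is itself reached. *)
Lemma cousin (R : realType) (P : R -> R -> Prop) (a b : R) :
  a <= b ->
  (forall u v w, u <= v -> v <= w -> P u v -> P v w -> P u w) ->
  (forall t, a <= t -> t <= b -> exists2 d, 0 < d &
     forall u v, a <= u -> u <= t -> t <= v -> v <= b -> v - u < d -> P u v) ->
  P a b.
Proof.
move=> ab Padd Ploc.
pose S := [set s | [/\ a <= s, s <= b & P a s]].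
have Sa : S a.
  by have [d d0 Pd] := Ploc a (lexx a) ab; split => //; apply: Pd; rewrite ?subrr.
have ubS : ubound S b by move=> s [].
have supS : has_sup S by split; [exists a | exists b].
have aS : a <= sup S by apply: ub_le_sup Sa; exists b.
have Sb : sup S <= b by apply: ge_sup ubS; exists a.
have [d d0 Pd] := Ploc (sup S) aS Sb.
have d20 : 0 < d / 2 by rewrite divr_gt0.
have [s [as_ sb Ps] sS] := sup_adherent d20 supS.
have sleS : s <= sup S by apply: ub_le_sup => //; exists b.
pose v := Num.min b (sup S + d / 2).
have vle1 : v <= b by rewrite /v ge_min lexx.
have vle2 : v <= sup S + d / 2 by rewrite /v ge_min lexx orbT.
have Sv : sup S <= v by rewrite /v le_min Sb /=; lra.
have Pv : P a v.
  by apply: (Padd _ s) => //; [lra|apply: Pd => //; lra].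
have vS : v <= sup S by apply: ub_le_sup => //; [exists b|split => //; lra].
suff <- : v = b by [].
by move: vS; rewrite /v; case: (leP b (sup S + d / 2)) => //; lra.
Qed.

(** The increment is split at [t]; each half is governed by a one-sided difference quotient within
    [e] of a nonpositive number. *)
Lemma derive_straddle (R : realType) (g : R -> R) (t e : R) :
  derivable g t 1 -> 'D_1 g t <= 0 -> 0 < e ->
  exists2 d, 0 < d & forall u v, u <= t -> t <= v -> v - u < d ->
    g v - g u <= e * (v - u).
Proof.
move=> dg g0 e0.
have : h^-1 *: (g (h *: 1 + t) - g t) @[h --> 0^'] --> 'D_1 g t by exact: dg.
move=> /cvgrPdist_lt /(_ e e0) /nbhs_ballP[d /= d0 Hd].
exists d => // u v ut tv vud.
have H h : h != 0 -> `|h| < d -> `|'D_1 g t - h^-1 * (g (h + t) - g t)| < e.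
  move=> h0 hd; have := Hd h; rewrite /ball /= sub0r normrN => /(_ hd h0).
  by rewrite /GRing.scale /= mulr1.
have Hv : g v - g t <= e * (v - t).
  have [->|vt] := eqVneq v t; first by rewrite !subrr mulr0.
  have vt0 : 0 < v - t by rewrite subr_gt0 lt_neqAle eq_sym vt.
  have := H (v - t); rewrite gt_eqF// gtr0_norm// subrK => /(_ isT).
  have -> : v - t < d by lra.
  move=> /(_ isT); rewrite ltr_norml => /andP[H1 _].
  have : (v - t)^-1 * (g v - g t) <= e by lra.
  by rewrite mulrC ler_pdivrMr.
have Hu : g t - g u <= e * (t - u).
  have [->|ut'] := eqVneq u t; first by rewrite !subrr mulr0.
  have ut0 : 0 < t - u by rewrite subr_gt0 lt_neqAle ut'.
  have := H (u - t); rewrite subr_eq0 ut' distrC gtr0_norm// subrK => /(_ isT).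
  have -> : t - u < d by lra.
  move=> /(_ isT); rewrite ltr_norml => /andP[H1 _].
  have : (t - u)^-1 * (g t - g u) <= e.
    by rewrite -[t - u]opprB invrN mulNr -mulrN opprB; lra.
  by rewrite mulrC ler_pdivrMr.
lra.
Qed.

(* Off a null set the straddle estimate bounds the increments of g by e times the
   length. The null set is covered by an open set of measure less than the
   modulus of absolute continuity, and Cousin's lemma glues the two kinds of
   intervals. *)
Lemma abs_cont_nonincreasing (R : realType) (g : R -> R) (a b : R) :
  a <= b -> abs_cont_on g a b ->
  {ae (@lebesgue_measure R), forall t, a <= t -> t < b ->
     derivable g t 1 /\ 'D_1 g t <= 0} ->
  g b <= g a.
Proof.
move=> ab acg [A0 [mA0 A00 sA0]].
(* The derivative is controlled only for [t < b], so the endpoint joins the exceptional set. *)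
have sA t : a <= t -> t <= b -> ~ (A0 `|` [set b]) t ->
    derivable g t 1 /\ 'D_1 g t <= 0.
  move=> at_ tb /not_orP[nA /eqP tb']; apply: contrapT => H; apply: nA; apply: sA0.
  by move=> /(_ at_); rewrite lt_neqAle tb' tb => /(_ isT).
pose A := A0 `|` [set b].
have mA : measurable A by apply: measurableU.
have muA : lebesgue_measure A = 0%E.
  apply: measure_negligible => //; apply: negligibleU.
    by apply/negligibleP.
  by apply/negligibleP; [exact: measurable_set1|exact: lebesgue_measure_set1].
rewrite -subr_le0; apply/ler_addgt0Pl => e' e'0; rewrite addr0.
pose e := e' / (b - a + 1).
have ba1 : 0 < b - a + 1 by lra.
have e0 : 0 < e by rewrite divr_gt0.
have -> : e' = e * (b - a) + e by rewrite -[X in _ + X]mulr1 -mulrDr divfK// gt_eqF.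
have [d d0 Hd] := acg e e0.
have [|U [oU AU muU]] := lebesgue_regularity_outer mA _ d0.
  by rewrite [X in (X < _)%E]muA.
have mU : measurable U by exact: measurable_realfun.open_measurable.
have {}muU : (lebesgue_measure U < d%:E)%E.
  apply: le_lt_trans muU; rewrite -[X in lebesgue_measure X](setUIDK U A).
  have mI := measurableI _ _ mU mA.
  apply: (le_trans (measureU2 lebesgue_measure mI (measurableD mU mA))).
  rewrite -[leRHS]add0e leeD2r// -[leRHS]muA.
  by apply: le_measure; rewrite ?inE//; exact: subIsetr.
(* the intervals [x i, y i] are those whose tag lies in the null set *)
pose P u v := exists k (x y : nat -> R),
  [/\ forall i, (i < k)%N -> u <= x i /\ x i <= y i /\ y i <= v,
      forall i, (i.+1 < k)%N -> y i <= x i.+1,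
      ((\sum_(i < k) (y i - x i))%:E <= lebesgue_measure (U `&` `[u, v[))%E &
      g v - g u <= e * (v - u) + \sum_(i < k) `|g (y i) - g (x i)| ].
suff [k [x [y [H1 H2 H3 H4]]]] : P a b.
  apply: (le_trans H4); rewrite lerD2l; apply/ltW/Hd => //.
  rewrite -lte_fin; apply: (le_lt_trans H3); apply: le_lt_trans muU.
  by apply: le_measure; rewrite ?inE//; exact: measurableI.
apply: cousin => //.
(* Gluing concatenates the two families; the measures add up because [[u, v[] and [[v, w[] are
   disjoint. *)
- move=> u v w uv vw [k1 [x1 [y1 [A1 B1 C1 D1]]]] [k2 [x2 [y2 [A2 B2 C2 D2]]]].
  pose cat (z1 z2 : nat -> R) i := if (i < k1)%N then z1 i else z2 (i - k1)%N.
  have cat1 z1 z2 (i : 'I_k1) : cat z1 z2 i = z1 i by rewrite /cat ltn_ord.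
  have cat2 z1 z2 (i : 'I_k2) : cat z1 z2 (k1 + i)%N = z2 i.
    by rewrite /cat ltnNge leq_addr /= addKn.
  have catS (F : R -> R -> R) :
      \sum_(i < k1 + k2) F (cat x1 x2 i) (cat y1 y2 i) =
      \sum_(i < k1) F (x1 i) (y1 i) + \sum_(i < k2) F (x2 i) (y2 i).
    rewrite big_split_ord; congr (_ + _); apply: eq_bigr => i _ /=.
      by rewrite !cat1.
    by rewrite !cat2.
  have kP i : (i < k1 + k2)%N -> (k1 <= i)%N -> (i - k1 < k2)%N.
    by move=> ik ki; rewrite ltn_subLR.
  exists (k1 + k2)%N, (cat x1 x2), (cat y1 y2); split.
  + move=> i ik; rewrite /cat; case: ltnP => [/A1|/(kP _ ik)/A2]; lra.
  + move=> i ik; rewrite /cat; case: (ltnP i.+1 k1) => [ik1|ik1].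
      by rewrite (ltnW ik1); exact: B1.
    case: ltnP => ik2.
      have := A1 _ ik2; have := A2 _ (kP _ ik ik1); lra.
    by rewrite subSn//; apply: B2; rewrite -subSn// kP.
  + rewrite (catS (fun x y => y - x)) EFinD; apply: (le_trans (leeD C1 C2)).
    have mI r s : measurable (U `&` `[r, s[) by exact: measurableI.
    have mUU := measurableU _ _ (mI u v) (mI v w).
    rewrite -measureU; [|exact: mI|exact: mI|].
      apply: le_measure; rewrite ?inE; [exact: mUU|exact: mI|].
      by move=> s [] [Us] /=; rewrite !in_itv /= => /andP[us sv]; split => //=; lra.
    rewrite -subset0 => s [] [_ /=]; rewrite in_itv /= => /andP[_ sv] [_ /=].
    rewrite in_itv /= => /andP[vs _]; lra.
  + rewrite (catS (fun x y => `|g y - g x|)); lra.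
- move=> t at_ tb; have [At|nAt] := pselect (A t); last first.
    have [dg g0] := sA _ at_ tb nAt.
    have [r r0 Hr] := derive_straddle dg g0 e0.
    exists r => // u v _ ut tv _ vu; exists 0%N, (cst 0), (cst 0).
    by split => //; rewrite big_ord0 ?measure_ge0// addr0 Hr.
  have /nbhs_ballP[r /= r0 Hr] : nbhs t U by apply: open_nbhs_nbhs; split => //; exact: AU.
  exists r => // u v _ ut tv _ vu; exists 1%N, (cst u), (cst v).
  split => //; rewrite ?big_ord1 /=; first by move=> *; lra.
    rewrite setIidr; last first.
      move=> s /=; rewrite in_itv /= => /andP[us sv]; apply: Hr; rewrite /ball /=.
      by rewrite ltr_norml; lra.
    by rewrite lebesgue_measure_itv /= lte_fin; case: ltP => // ?; rewrite lee_fin; lra.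
  by apply: (le_trans (ler_norm _)); rewrite lerDr mulr_ge0//; lra.
Qed.

(** * Euclidean inner product against the maximum norm *)

Section dotp.
Context {R : realType} {n : nat}.
Implicit Types x y z : 'rV[R]_n.

Lemma dotpDl x y z : dotp (x + y) z = dotp x z + dotp y z.
Proof.
by rewrite /dotp -big_split; apply: eq_bigr => i _; rewrite mxE mulrDl.
Qed.

Lemma dotpNN x y : dotp (- x) (- y) = dotp x y.
Proof. by apply: eq_bigr => i _; rewrite !mxE mulrNN. Qed.

Lemma dotp_ge0 x : 0 <= dotp x x.
Proof. by apply: sumr_ge0 => i _; rewrite -expr2 sqr_ge0. Qed.

Lemma dotpBB x y : dotp x x - dotp y y = dotp (x - y) (x + y).
Proof. by rewrite -sumrB; apply: eq_bigr => i _; rewrite !mxE; lra. Qed.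

Lemma coord_le_norm x i : `|x ord0 i| <= `|x|.
Proof.
rewrite [leRHS]mx_normrE.
exact: (@le_bigmax _ _ _ 0 (fun ij : 'I_1 * 'I_n => `|x ij.1 ij.2|) (ord0, i)).
Qed.

(** The norm is the largest absolute entry, so each of the [n] products is at most [|x| * |y|]. *)
Lemma normr_dotp_le x y : `|dotp x y| <= n%:R * (`|x| * `|y|).
Proof.
apply: (le_trans (ler_norm_sum _ _ _)).
apply: (@le_trans _ _ (\sum_(i < n) (`|x| * `|y|))); last first.
  by rewrite sumr_const card_ord mulr_natl.
by apply: ler_sum => i _; rewrite normrM ler_pM// coord_le_norm.
Qed.

Lemma sqr_norm_le_dotp x : `|x| ^+ 2 <= dotp x x.
Proof.
have [->|x0] := eqVneq x 0; first by rewrite normr0 expr0n dotp_ge0.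
have [[i j] /=] : exists ij : 'I_1 * 'I_n, `|x| = `|x ij.1 ij.2|.
  by apply: mx_norm_neq0; move: x0; rewrite -normr_eq0.
rewrite (ord1 i) => ->; rewrite real_normK ?num_real// /dotp (bigD1 j)//=.
by rewrite -expr2 lerDl sumr_ge0// => k _; rewrite -expr2 sqr_ge0.
Qed.

Lemma is_derive_sqr_dist (phi : R -> 'rV[R]_n) z (t : R) :
  derivable phi t 1 ->
  is_derive t (1 : R) (fun s => dotp (phi s - z) (phi s - z))
    (2 * dotp ('D_1 phi t) (phi t - z)).
Proof.
move=> dphi.
pose h (i : 'I_n) : R -> R := (fun s => phi s ord0 i) - cst (z ord0 i).
have dh i : is_derive t (1 : R) (h i) ('D_1 phi t ord0 i - 0).
  apply: is_deriveB; rewrite derive_mx// mxE.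
  by apply/derivableP; move/derivable_mxP : dphi; exact.
have := is_derive_sum (fun i => is_deriveX 2 (dh i)).
congr (is_derive _ _ _ _).
  apply/funext => s; rewrite fct_sumE; apply: eq_bigr => i _.
  by rewrite !mxE expr2.
rewrite /dotp mulr_sumr; apply: eq_bigr => i _.
by rewrite /GRing.scale /= !mxE expr1 /h /= subr0 mulrAC mulrA.
Qed.

End dotp.

(** * Permanence properties of absolute continuity *)

Section abs_cont.
Context {R : realType}.
Implicit Types (V W : normedModType R) (a b : R).

Lemma abs_cont_on_sub V (f : R -> V) a b c d :
  a <= c -> d <= b -> abs_cont_on f a b -> abs_cont_on f c d.
Proof.
move=> ac db acf e e0; have [r r0 Hr] := acf e e0; exists r => // k x y xy.
by apply: Hr => i /xy; lra.
Qed.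

Lemma abs_cont_on_lipschitz V W (f : R -> V) (g : R -> W) (K : R) a b :
  abs_cont_on f a b ->
  (forall s t, a <= s -> s <= t -> t <= b -> `|g t - g s| <= K * `|f t - f s|) ->
  abs_cont_on g a b.
Proof.
(* [K] may be nonpositive; [L] dominates it and can be divided by. *)
move=> acf gf e e0; pose L := `|K| + 1.
have L0 : 0 < L by rewrite /L; have := normr_ge0 K; lra.
have [r r0 Hr] := acf (e / L) (divr_gt0 e0 L0).
exists r => // k x y xy yx sr; apply: (@le_lt_trans _ _ (L * \sum_(i < k) `|f (y i) - f (x i)|)).
  rewrite mulr_sumr; apply: ler_sum => i _.
  have [xi [xiyi yi]] := xy i (ltn_ord i).
  apply: (le_trans (gf _ _ xi xiyi yi)); rewrite ler_wpM2r//.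
  by rewrite /L; have := ler_norm K; lra.
by rewrite mulrC -ltr_pdivlMr//; exact: Hr.
Qed.

Lemma abs_cont_onD V (f g : R -> V) a b :
  abs_cont_on f a b -> abs_cont_on g a b -> abs_cont_on (fun t => f t + g t) a b.
Proof.
move=> acf acg e e0; have e20 : 0 < e / 2 by rewrite divr_gt0.
have [r r0 Hr] := acf _ e20; have [s s0 Hs] := acg _ e20.
exists (Num.min r s); first by rewrite lt_min r0.
move=> k x y xy yx; rewrite lt_min => /andP[sr ss].
have := Hr k x y xy yx sr; have := Hs k x y xy yx ss => H1 H2.
apply: (@le_lt_trans _ _ (\sum_(i < k) (`|f (y i) - f (x i)| + `|g (y i) - g (x i)|))).
  by apply: ler_sum => i _; rewrite opprD addrACA ler_normD.
by rewrite big_split/=; lra.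
Qed.

Lemma abs_cont_on_linear (c : R) a b : abs_cont_on (fun t : R => c * t) a b.
Proof.
apply: (@abs_cont_on_lipschitz _ _ id _ `|c|).
  move=> e e0; exists e => // k x y xy _; apply: le_lt_trans.
  by apply: ler_sum => i _; rewrite ger0_norm//; have := xy i (ltn_ord i); lra.
by move=> s t _ _ _; rewrite -mulrBr normrM.
Qed.

End abs_cont.

(** * Semicontinuity of convex functions *)

Section convex.
Context {R : realType} {n : nat}.
Implicit Types (f : 'rV[R]_n -> R) (x h : 'rV[R]_n).

Lemma convex_fun_mid f x h : convex_fun f ->
  f (2^-1 *: (x + h)) <= 2^-1 * f x + 2^-1 * f h.
Proof.
move=> cf; have := cf x h 2^-1; rewrite scalerDr.
have -> : 1 - 2^-1 = 2^-1 :> R by lra.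
by apply; lra.
Qed.

(** This is the chord bound; adding the deviations at [x + h] and [x - h] makes it symmetric in the
    sign of [r]. *)
Lemma convex_fun_ray f x h (r : R) : convex_fun f -> `|r| <= 1 ->
  f (x + r *: h) <= f x + `|r| * (`|f (x + h) - f x| + `|f (x - h) - f x|).
Proof.
move=> cf r1.
wlog r0 : h r r1 / 0 <= r => [hw|].
  have [|/ltW] := leP 0 r; first exact: hw.
  rewrite -oppr_ge0 => r0; have := hw (- h) (- r).
  rewrite normrN opprK scalerN scaleNr opprK => /(_ r1 r0).
  by rewrite (addrC `|f (x - h) - f x|).
rewrite ger0_norm// in r1 *.
have := cf (x + h) x r r0 r1.
have -> : r *: (x + h) + (1 - r) *: x = x + r *: h.
  by rewrite scalerDr scalerBl scale1r addrAC addrCA subrr addr0.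
move=> H; have H1 := ler_norm (f (x + h) - f x).
have : r * (f (x + h) - f x) <= r * (`|f (x + h) - f x| + `|f (x - h) - f x|).
  by rewrite ler_wpM2l//; have := normr_ge0 (f (x - h) - f x); lra.
lra.
Qed.

(* Induction on the number k of leading coordinates in which h may be nonzero. *)
Lemma convex_fun_usc f x (e : R) : convex_fun f -> 0 < e ->
  exists2 d : R, 0 < d & forall h, `|h| < d -> f (x + h) <= f x + e.
Proof.
move=> cf e0.
suff : forall k (e : R), 0 < e -> exists2 d : R, 0 < d & forall h, `|h| < d ->
    (forall i : 'I_n, (k <= i)%N -> h ord0 i = 0) -> f (x + h) <= f x + e.
  move=> /(_ n e e0)[d d0 Hd]; exists d => // h hd; apply: Hd => // i.
  by rewrite leqNgt ltn_ord.
elim=> [|k IH] {}e {}e0.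
  exists 1 => // h _ h0; have -> : h = 0.
    by apply/rowP => i; rewrite h0// mxE.
  by rewrite addr0 lerDl ltW.
have [kn|nk] := ltnP k n; last first.
  have [d d0 Hd] := IH e e0; exists d => // h hd hk; apply: Hd => // i.
  by rewrite leqNgt (leq_trans (ltn_ord i) nk).
pose j := Ordinal kn; pose ej : 'rV[R]_n := delta_mx ord0 j.
pose K := `|f (x + ej) - f x| + `|f (x - ej) - f x|.
have K0 : 0 <= K by rewrite addr_ge0.
have [d d0 Hd] := IH e e0.
have K10 : 0 < K + 1 by lra.
(* The three bounds serve for [|2 *: h'| < d], [|2 * s| <= 1] and [|2 * s| * K <= e]; [K + 1] avoids
   a zero divisor. *)
exists (Num.min (d / 2) (Num.min (2^-1) (e / (K + 1) / 2))).
  by rewrite !lt_min !divr_gt0//= invr_gt0 ltr0n.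
move=> h; rewrite !lt_min => /and3P[h1 h2 h3] hk.
pose s := h ord0 j; pose h' := h - s *: ej.
have sh : `|s| <= `|h| by exact: coord_le_norm.
have h'i i : h' ord0 i = if i == j then 0 else h ord0 i.
  rewrite !mxE eqxx /=; case: eqVneq => [->|]; first by rewrite mulr1 subrr.
  by rewrite mulr0 subr0.
have h'h : `|h'| <= `|h|.
  rewrite [leLHS]mx_normrE; apply/bigmax_leP; split => // -[i l] _ /=.
  by rewrite (ord1 i) h'i; case: eqP => _; rewrite ?normr0// coord_le_norm.
(* [x + h] is the midpoint of a point displaced in the first [k] coordinates only and one displaced
   along [ej]; at both, [f] is at most [f x + e]. *)
have -> : x + h = 2^-1 *: ((x + 2 *: h') + (x + (2 * s) *: ej)).
  rewrite addrACA -mulr2n -[x *+ 2]scaler_nat -scalerA -!scalerDr scalerA mulVf// scale1r.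
  by rewrite subrK.
apply: (le_trans (convex_fun_mid _ _ cf)).
have H1 : f (x + 2 *: h') <= f x + e.
  apply: Hd; first by rewrite normrZ gtr0_norm//; lra.
  move=> i ki; rewrite mxE h'i; case: eqVneq => [|ij]; first by rewrite mulr0.
  by rewrite hk ?mulr0// ltn_neqAle ki andbT eq_sym.
have H2 : f (x + (2 * s) *: ej) <= f x + `|2 * s| * K.
  by apply: convex_fun_ray => //; rewrite normrM gtr0_norm//; lra.
suff : `|2 * s| * K <= e by lra.
apply: (@le_trans _ _ (e / (K + 1) * (K + 1))); last by rewrite divfK// gt_eqF.
by apply: ler_pM => //; [rewrite normrM gtr0_norm//; lra|lra].
Qed.

Lemma convex_fun_lsc f x (e : R) : convex_fun f -> 0 < e ->
  \forall y \near x, f x - e <= f y.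
Proof.
move=> cf e0; have [d d0 Hd] := convex_fun_usc x cf e0.
apply/nbhs_ballP; exists d => //= y; rewrite -ball_normE /= => xy.
(* x is the midpoint of y and 2 x - y *)
have := convex_fun_mid y (x + (x - y)) cf.
rewrite addrCA subrKC -mulr2n -[x *+ 2]scaler_nat scalerA mulVf// scale1r.
by have := Hd _ xy; lra.
Qed.

End convex.

(** * Boundedness and squared distances along absolutely continuous curves *)

Lemma abs_cont_dist (R : realType) (V : normedModType R) (f : R -> V) (a b e : R) :
  abs_cont_on f a b -> 0 < e ->
  exists2 d, 0 < d & forall s t, a <= s -> s <= t -> t <= b -> t - s < d ->
    `|f t - f s| < e.
Proof.
move=> acf e0; have [d d0 Hd] := acf e e0; exists d => // s t as_ st tb std.
have := Hd 1%N (cst s) (cst t); rewrite !big_ord1 /=; apply => //.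
Qed.

(** Bounds on adjacent intervals combine by their maximum, so Cousin's lemma reduces the claim to
    short intervals. *)
Lemma abs_cont_bounded (R : realType) (V : normedModType R) (f : R -> V) (a b : R) :
  a <= b -> abs_cont_on f a b ->
  exists M, forall t, a <= t -> t <= b -> `|f t| <= M.
Proof.
move=> ab acf.
apply: (cousin (P := fun u v => exists M, forall t, u <= t -> t <= v -> `|f t| <= M)) => //.
  move=> u v w _ _ [M HM] [N HN]; exists (Num.max M N) => t ut tw.
  by rewrite le_max; have [/(HM _ ut) ->//|/ltW/HN ->//] := leP t v; rewrite orbT.
have [d d0 Hd] := abs_cont_dist acf ltr01.
move=> t at_ tb; exists d => // u v au ut tv vb vud.
exists (`|f u| + 1) => s us sv.
rewrite -[f s](subrK (f u)) (le_trans (ler_normD _ _))// addrC lerD2l ltW//.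
by apply: Hd => //; lra.
Qed.

(** A difference of squared distances is the product of [phi t - phi s] with a bounded vector, hence
    Lipschitz in [phi]. *)
Lemma abs_cont_sqr_dist (R : realType) (n : nat) (phi : R -> 'rV[R]_n)
    (z : 'rV[R]_n) (a b : R) :
  a <= b -> abs_cont_on phi a b ->
  abs_cont_on (fun s => dotp (phi s - z) (phi s - z)) a b.
Proof.
move=> ab acphi; have [M HM] := abs_cont_bounded ab acphi.
apply: (abs_cont_on_lipschitz (K := n%:R * ((M + `|z|) + (M + `|z|))) acphi).
move=> s t as_ st tb; rewrite dotpBB (le_trans (normr_dotp_le _ _))//.
have -> : phi t - z - (phi s - z) = phi t - phi s by rewrite opprB addrA subrK.
rewrite -mulrA ler_wpM2l// mulrC ler_wpM2r// (le_trans (ler_normD _ _))//.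
by apply: lerD; rewrite (le_trans (ler_normB _ _))// lerD2r HM//; lra.
Qed.

(** * The differential inclusion and the time spent in a mode *)

Lemma Mop_dotp (R : realType) (n : nat) (f : 'rV[R]_n -> R) (C : set 'rV[R]_n)
    (x y v : 'rV[R]_n) :
  Mop f C x v -> C y -> dotp v (y - x) <= f y - f x.
Proof.
move=> [a [b [Ha [_ Hb] ->]]] Cy; rewrite dotpDl.
by have := Ha y; have := Hb y Cy; lra.
Qed.

Lemma Mop_dom (R : realType) (n : nat) (f : 'rV[R]_n -> R) (C : set 'rV[R]_n)
    (x v : 'rV[R]_n) : Mop f C x v -> C x.
Proof. by move=> [a [b [_ [Cx _] _]]]. Qed.

(** The time spent in mode [q] is the union of the intervals [B j]; countable subadditivity bounds
    it by the sum of their lengths. *)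
Lemma measure_switching_le (R : realType) (Q : eqType) (sigma : R -> Q)
    (tj : nat -> R) (q : Q) (M : R) :
  tj 0%N = 0 -> tj @ \oo --> +oo ->
  (forall j s, tj j <= s -> s < tj j.+1 -> sigma s = sigma (tj j)) ->
  (forall j, tj j < tj j.+1) ->
  (forall m, \sum_(j < m) (if sigma (tj j) == q then tj j.+1 - tj j else 0) <= M) ->
  (lebesgue_measure [set t | (0 <= t)%R /\ sigma t = q] <= M%:E)%E.
Proof.
move=> tj0 tjoo stj tjS HM.
pose B j : set R := if sigma (tj j) == q then `[tj j, tj j.+1[%classic else set0.
have mB j : measurable (B j) by rewrite /B; case: ifP.
have tj_ge0 j : 0 <= tj j.
  by elim: j => [|j /le_trans -> //]; rewrite ?tj0// ltW.
have -> : [set t | 0 <= t /\ sigma t = q] = \bigcup_j B j.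
  apply/seteqP; split => t /=.
    move=> [t0 st].
    have [j tj_t] : exists j, t < tj j.
      by have /cvgryPgt/(_ t)[N _ HN] := tjoo; exists N; apply: HN => /=.
    (* The least [j] with [t < tj j] is not [0], since [tj 0 = 0 <= t]; its predecessor starts the
       interval containing [t]. *)
    have [[|k] tk kmin] := ex_minnP (ex_intro (fun j => t < tj j) j tj_t).
      by move: tk; rewrite tj0; lra.
    have tk1 : tj k <= t.
      by rewrite leNgt; apply/negP => /kmin; rewrite ltnn.
    exists k => //; rewrite /B -(stj _ _ tk1 tk) st eqxx /= in_itv /=.
    by rewrite tk1.
  move=> [j _]; rewrite /B; case: eqP => // sj /=; rewrite in_itv /= => /andP[t1 t2].
  by split; [exact: le_trans t1|rewrite (stj _ _ t1 t2)].
have mUB := bigcupT_measurable _ mB.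
apply: (le_trans (measure_sigma_subadditive lebesgue_measure mB mUB _)) => //.
apply: lime_le; first by apply: is_cvg_nneseries => *; exact: measure_ge0.
apply: nearW => m; rewrite big_mkord.
rewrite (eq_bigr (fun j : 'I_m =>
  (if sigma (tj j) == q then tj j.+1 - tj j else 0)%:E)).
  by rewrite sumEFin lee_fin; exact: HM.
move=> j _; rewrite /B; case: eqP => _; last by rewrite measure0.
by rewrite [LHS]lebesgue_measure_itv /= lte_fin tjS.
Qed.

(** * Local estimates near a cluster point *)

Section near_cluster_point.
Context {R : realType} {n : nat} (f : 'rV[R]_n -> R) (C : set 'rV[R]_n).
Context (cf : convex_fun f) (cC : closed C).
Implicit Types x z : 'rV[R]_n.

(** If [f z < f x], averaging leaves half the gap as slack for lower semicontinuity at [x];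
    otherwise minimality of [z] suffices. *)
Lemma near_average_le x z : argmin_on f C z ->
  \forall y \near x, C y -> C x /\ f x + f z <= 2 * f y.
Proof.
move=> [Cz zmin]; have [Cx|nCx] := pselect (C x); last first.
  have : nbhs x (~` C).
    by apply: open_nbhs_nbhs; split => //; exact: closed_openC.
  by apply: (@filterS _ (nbhs x)) => y nCy /nCy.
have [xz|zx] := leP (f x) (f z).
  by apply: (@nearW _ (nbhs x)) => y Cy; split => //; have := zmin y Cy; lra.
have e0 : 0 < (f x - f z) / 2 by rewrite divr_gt0// subr_gt0.
by apply: (@filterS _ (nbhs x)) (convex_fun_lsc x cf e0) => y Hy _; split => //; lra.
Qed.

Lemma near_gap x z : argmin_on f C z -> ~ argmin_on f C x ->
  exists2 d, 0 < d & \forall y \near x, C y -> f z + d <= f y.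
Proof.
move=> [Cz zmin] xmin; have [Cx|nCx] := pselect (C x); last first.
  (* The complement of [C] is a neighbourhood of [x], so the claim is vacuous and any positive [d]
     will do. *)
  exists 1 => //.
  have : nbhs x (~` C).
    by apply: open_nbhs_nbhs; split => //; exact: closed_openC.
  by apply: (@filterS _ (nbhs x)) => y nCy /nCy.
have zx : f z < f x.
  rewrite ltNge; apply/negP => xz; apply: xmin; split => // y /zmin.
  exact: le_trans.
have e0 : 0 < (f x - f z) / 2 by rewrite divr_gt0// subr_gt0.
by exists ((f x - f z) / 2) => //; apply: (@filterS _ (nbhs x)) (convex_fun_lsc x cf e0) => y Hy _; lra.
Qed.

End near_cluster_point.

(** * Descent along a solution *)

Section complete_solution.
Context {R : realType} {n p : nat}.
Context (f : 'I_p -> 'rV[R]_n -> R) (C : 'I_p -> set 'rV[R]_n).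
Context (sigma : R -> 'I_p) (phi : R -> 'rV[R]_n).
Context (hphi : complete_solution f C sigma phi).

Let V (z : 'rV[R]_n) (t : R) := dotp (phi t - z) (phi t - z).

Lemma sqr_dist_abs_cont z a b : 0 <= a -> a <= b -> abs_cont_on (V z) a b.
Proof.
move=> a0 ab; apply: abs_cont_sqr_dist => //.
by apply: (abs_cont_on_sub a0 (lexx b)); apply: hphi.1; exact: le_trans ab.
Qed.

(** Common source of all descent estimates: [x = z], [c = 0] gives monotonicity; a cluster point [x]
    with [c = 0] confines the solution; [x = z], [c > 0] gives decrease at a fixed rate. *)
Lemma sqr_dist_descent x z c a b : 0 <= a -> a <= b ->
  (forall t, a <= t -> t < b -> C (sigma t) (phi t) ->
    [/\ C (sigma t) x, C (sigma t) z &
        f (sigma t) x + f (sigma t) z + c <= 2 * f (sigma t) (phi t)]) ->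
  V x b + V z b + 2 * c * b <= V x a + V z a + 2 * c * a.
Proof.
move=> a0 ab H.
apply: (abs_cont_nonincreasing (g := fun t => V x t + V z t + 2 * c * t)) => //.
  apply: abs_cont_onD; last exact: abs_cont_on_linear.
  by apply: abs_cont_onD; exact: sqr_dist_abs_cont.
apply: (@filterS _ (almost_everywhere lebesgue_measure)) hphi.2 => t Ht at_ tb.
have [dphi Mphi] := Ht (le_trans a0 at_).
have [Cx Cz xz] := H t at_ tb (Mop_dom Mphi).
have dg : is_derive t (1 : R) (fun t => V x t + V z t + 2 * c * t)
    (2 * dotp ('D_1 phi t) (phi t - x) + 2 * dotp ('D_1 phi t) (phi t - z) + 2 * c).
  apply: is_deriveD.
    by apply: is_deriveD; exact: is_derive_sqr_dist.
  have := is_deriveZ (2 * c) (is_derive_id t (1 : R)).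
  by rewrite /GRing.scale /= mulr1.
split; first exact: ex_derive.
(* The operator contains [- 'D_1 phi t], so both factors of each product change sign. *)
rewrite derive_val -[phi t - x]opprB -[phi t - z]opprB.
rewrite -['D_1 phi t]opprK !dotpNN.
by have := Mop_dotp Mphi Cx; have := Mop_dotp Mphi Cz; lra.
Qed.

Section fejer.
Context (z : 'rV[R]_n) (Az : forall q, argmin_on (f q) (C q) z).

Lemma fejer_monotone a b : 0 <= a -> a <= b -> V z b <= V z a.
Proof.
move=> a0 ab; have : V z b + V z b + 2 * 0 * b <= V z a + V z a + 2 * 0 * a.
  apply: sqr_dist_descent => // t at_ tb Cphi; have [Cz zmin] := Az (sigma t).
  by split => //; have := zmin _ Cphi; lra.
by lra.
Qed.

Lemma solution_cluster_point : exists x, cluster (phi t @[t --> +oo]) x.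
Proof.
(* A norm [r] with [r ^ 2 <= V z 0] satisfies [r <= V z 0 + 1], because [(r - 1) ^ 2 >= 0]; no
   square root is needed. *)
pose B := closed_ball z (V z 0 + 1).
have V0 : 0 < V z 0 + 1 by have := dotp_ge0 (phi 0 - z); rewrite /V; lra.
have cB : compact B.
  apply: bounded_closed_compact; last exact: closed_ball_closed.
  exists (`|z| + (V z 0 + 1)); split; first exact: num_real.
  move=> M ltM y; rewrite /B closed_ballE// /closed_ball_ /= => By.
  rewrite -[y](subKr z) (le_trans (ler_normB _ _))// (le_trans _ (ltW ltM))//.
  by rewrite lerD2l.
have FB : \forall t \near +oo, B (phi t).
  near=> t; rewrite /= /B closed_ballE// /closed_ball_ /=.
  have t0 : 0 <= t by near: t; exact: nbhs_pinfty_ge.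
  have := le_trans (sqr_norm_le_dotp (phi t - z)) (fejer_monotone (lexx 0) t0).
  rewrite (distrC z) => H; have := sqr_ge0 (`|phi t - z| - 1); lra.
have [x [_ clx]] := cB (phi t @[t --> +oo]) _ FB.
by exists x.
Unshelve. all: by end_near. Qed.

(** Continuity from the right is what shows that the infimum of the times spent outside a ball is
    itself such a time. *)
Lemma sqr_dist_lt_after x t e : 0 <= t -> 0 < e ->
  exists2 d, 0 < d & forall s, t <= s -> s < t + d -> V x s < V x t + e.
Proof.
move=> t0 e0.
have [|d d0 Hd] := abs_cont_dist (@sqr_dist_abs_cont x t (t + 1) t0 _) e0.
  by lra.
exists (Num.min d 1); first by rewrite lt_min d0 ltr01.
move=> s ts; rewrite -ltrBlDl lt_min => /andP[sd s1].
have := Hd t s (lexx t) ts; rewrite ltr_norml => H.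
have /andP[] : - e < V x s - V x t < e by apply: H; lra.
by lra.
Qed.

(** * Convergence and identification of the limit *)

Context (cf : forall q, convex_fun (f q)) (cC : forall q, closed (C q)).

Lemma cluster_point_cvg x :
  cluster (phi t @[t --> +oo]) x -> phi t @[t --> +oo] --> x.
Proof.
move=> clx; apply/cvgrPdist_lt => e e0.
have Hnear : \forall y \near x, forall q, C q y ->
    C q x /\ f q x + f q z <= 2 * f q y.
  apply: (@filter_forall _ _ _ (nbhs x)) => q.
  by apply: near_average_le => //; exact: Az.
have [d /= d0 Hd] : exists2 d : R, 0 < d & forall y, `|x - y| < d ->
    forall q, C q y -> C q x /\ f q x + f q z <= 2 * f q y.
  have /nbhs_ballP[d /= d0 Hd] := Hnear; exists d => // y xy.
  by apply: Hd; rewrite -ball_normE.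
pose r := Num.min d e.
have r0 : 0 < r by rewrite lt_min d0.
have rd : r <= d by rewrite ge_min lexx.
have re : r <= e by rewrite ge_min lexx orbT.
(* [V x] is Euclidean and [r] is a radius for the maximum norm; [V x t < r ^ 2] puts [phi t] within
   [r] of [x]. *)
pose rho := r ^+ 2.
have rho0 : 0 < rho by rewrite exprn_gt0.
have rho20 : 0 < rho / 2 by rewrite divr_gt0.
have Vr t : V x t < rho -> `|x - phi t| < r.
  move=> Vt; rewrite distrC -(ltr_pXn2r (ltn0Sn 1)) ?nnegrE ?(ltW r0)//.
  exact: le_lt_trans (sqr_norm_le_dotp _) Vt.
(* From the time [T] extracted below, [V z] can drop by less than [rho / 2] in all. *)
pose S := [set V z t | t in [set t | 0 <= t]].
have iS : has_inf S.
  split; first by exists (V z 0); exists 0 => /=.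
  by exists 0 => _ [t _ <-]; exact: dotp_ge0.
have [_ [T /= T0 <-] VT] := inf_adherent rho20 iS.
have VS t : 0 <= t -> inf S <= V z t.
  by move=> t0; apply: ge_inf; [exact: iS.2|exists t].
(* Within [s <= 1] of [x] in the maximum norm, [V x] is at most [n * s ^ 2 <= n * s < rho / 2]. *)
pose s := Num.min 1 (rho / 2 / (n%:R + 1)).
have n1 : 0 < n%:R + 1 :> R by rewrite ltr_wpDl.
have s0 : 0 < s by rewrite lt_min ltr01 divr_gt0.
have [t0 [Tt0 Vt0]] : exists t0, T <= t0 /\ V x t0 < rho / 2.
  have Ft : \forall t \near +oo, [set phi t | t in [set t | T <= t]] (phi t).
    by near=> t; exists t => //=; near: t; exact: nbhs_pinfty_ge.
  have [_ [[t /= Tt <-]]] := clx _ _ Ft (nbhsx_ballx x s s0).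
  rewrite -ball_normE /= distrC => ts; exists t; split => //.
  have := normr_dotp_le (phi t - x) (phi t - x); have := ler_norm (V x t).
  rewrite -/(V x t) => H1 H2.
  have ts1 : `|phi t - x| * `|phi t - x| <= s.
    apply: (@le_trans _ _ (s * 1)); last by rewrite mulr1.
    apply: ler_pM => //; first exact: ltW.
    by apply: (le_trans (ltW ts)); rewrite ge_min lexx.
  have s2 : (n%:R + 1) * s <= rho / 2.
    by rewrite mulrC -ler_pdivlMr// ge_min lexx orbT.
  have : n%:R * (`|phi t - x| * `|phi t - x|) <= n%:R * s by rewrite ler_wpM2l.
  by rewrite mulrDl mul1r in s2; lra.
have t00 : 0 <= t0 by lra.
have stay t : t0 <= t -> V x t < rho.
  move=> t0t; rewrite ltNge; apply/negP => Vt.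
  (* At the first exit time [inf E], [V x] is at least [rho]. Up to then [V x + V z] does not
     increase, so [V x] gains at most the drop of [V z] and remains below [rho / 2 + rho / 2]. *)
  pose E := [set u | t0 <= u /\ rho <= V x u].
  have iE : has_inf E by split; [exists t | exists t0 => u []].
  have lbE u : E u -> inf E <= u by move=> Eu; apply: ge_inf => //; exact: iE.2.
  have t0u : t0 <= inf E by apply: lb_le_inf; [exact: iE.1 | move=> u []].
  have u0 : 0 <= inf E by lra.
  have VE : rho <= V x (inf E).
    rewrite leNgt; apply/negP => Vu.
    have e'0 : 0 < rho - V x (inf E) by lra.
    have [d' d'0 Hd'] := sqr_dist_lt_after x u0 e'0.
    have [u [Eu1 Eu2] uE] := inf_adherent d'0 iE.
    by have := Hd' u (lbE u (conj Eu1 Eu2)) uE; lra.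
  have : V x (inf E) + V z (inf E) + 2 * 0 * inf E <=
         V x t0 + V z t0 + 2 * 0 * t0.
    apply: sqr_dist_descent => // u t0u' uE Cphi.
    have Vu : V x u < rho.
      rewrite ltNge; apply/negP => Vu.
      by have := lbE u (conj t0u' Vu); lra.
    have [|Cx Hx] := Hd (phi u) _ _ Cphi; first by have := Vr u Vu; lra.
    by split => //; [exact: (Az _).1|rewrite addr0].
  by have := VS _ u0; have := fejer_monotone T0 Tt0; lra.
near=> t.
apply: (lt_le_trans (Vr t _) re); apply: stay.
by near: t; apply: nbhs_pinfty_ge; exact: num_real.
Unshelve. all: by end_near. Qed.

(** Otherwise, by [near_gap], [V z] eventually loses at least [d] per unit of time spent in mode
    [q]; as [V z >= 0], that time would be finite. *)
Lemma limit_argmin x q : switching_signal sigma ->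
  (@lebesgue_measure R) [set t | 0 <= t /\ sigma t = q] = +oo%E ->
  phi t @[t --> +oo] --> x -> argmin_on (f q) (C q) x.
Proof.
move=> [tj [tj0 tjS tjoo stj]] muq phix; apply: contrapT => nx.
have [d d0 Hd] := near_gap (@cf q) (@cC q) (Az q) nx.
have [t0 [_ Ht0]] : \forall t \near +oo, C q (phi t) -> f q z + d <= f q (phi t).
  exact: phix Hd.
have /cvgryPgt/(_ (Num.max t0 0))[J _ HJ] := tjoo.
pose c j := if sigma (tj j) == q then tj j.+1 - tj j else 0.
have cV j : (J <= j)%N -> d * c j <= V z (tj j) - V z (tj j.+1).
  move=> /HJ /=; rewrite gt_max => /andP[t0j j0].
  have jS := ltW (tjS j); rewrite /c; case: eqP => sj; last first.
    by rewrite mulr0; have := fejer_monotone (ltW j0) jS; lra.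
  have : V z (tj j.+1) + V z (tj j.+1) + 2 * d * tj j.+1 <=
         V z (tj j) + V z (tj j) + 2 * d * tj j.
    apply: sqr_dist_descent => //; first exact: ltW.
    move=> t jt tj1; rewrite (stj _ _ jt tj1) sj => Cphi.
    have Cz := (Az q).1; split => //.
    by have := Ht0 t (lt_le_trans t0j jt) Cphi; lra.
  by lra.
(* From [J] on, the partial sum of [c] plus [V z / d] does not increase; [M] is its value at [J]. *)
pose M := \sum_(j < J) c j + V z (tj J) / d.
have c_ge0 j : 0 <= c j by rewrite /c; case: ifP => // _; rewrite subr_ge0 ltW.
have HM m : \sum_(j < m) c j <= M.
  have HJm k : \sum_(j < J + k) c j + V z (tj (J + k)%N) / d <= M.
    elim: k => [|k IH]; first by rewrite addn0.
    rewrite addnS big_ord_recr /=; apply: le_trans IH.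
    have H := cV (J + k)%N (leq_addr _ _).
    have : c (J + k)%N <= (V z (tj (J + k)%N) - V z (tj (J + k).+1)) / d.
      by rewrite ler_pdivlMr// mulrC.
    by rewrite mulrBl; lra.
  have := HJm m; have : 0 <= V z (tj (J + m)%N) / d by rewrite divr_ge0 ?dotp_ge0 ?ltW.
  suff : \sum_(j < m) c j <= \sum_(j < J + m) c j by lra.
  by rewrite addnC big_split_ord /= lerDl sumr_ge0.
by have := measure_switching_le tj0 tjoo stj tjS HM; rewrite muq.
Qed.

End fejer.
End complete_solution.

Theorem theorem1 (R : realType) (n p : nat)
  (f : 'I_p -> 'rV[R]_n -> R) (C : 'I_p -> set 'rV[R]_n)
  (hf : forall q, convex_fun (f q))
  (hCne : forall q, C q !=set0)
  (hCcl : forall q, closed (C q))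
  (hCcv : forall q, convex_set_rV (C q))
  (hA : (\bigcap_(q in [set: 'I_p]) argmin_on (f q) (C q)) !=set0)
  (sigma : R -> 'I_p) (hsigma : switching_signal sigma)
  (hmeas : forall q : 'I_p,
      (@lebesgue_measure R) [set t | 0 <= t /\ sigma t = q] = +oo%E)
  (phi : R -> 'rV[R]_n) (hphi : complete_solution f C sigma phi) :
  exists2 l : 'rV[R]_n, phi t @[t --> +oo] --> l &
    (\bigcap_(q in [set: 'I_p]) argmin_on (f q) (C q)) l.
Proof.
have [z Az] := hA.
have {}Az q : argmin_on (f q) (C q) z by exact: Az.
have [x clx] := solution_cluster_point hphi Az.
have phix := cluster_point_cvg hphi Az hf hCcl clx.
exists x => // q _.
exact: (limit_argmin hphi Az hf hCcl hsigma (hmeas q) phix).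
Qed.
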